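(* Let $\ell\geq 2$ be an integer and let $(e_m)_{m\geq0}$ be the sequence defined below. Then $$\gamma=\sum_{n=1}^{2^{\ell-1}-1}\frac1n-(\ell-1)\log 2+\sum_{m=1}^{\infty}\frac{(-1)^{m-1}e_m}{m+1}\sum_{2^{\ell-1}\leq n<2^{\ell}}\frac{1}{n^{m+1}},$$ where $\gamma$ is Euler's constant and the series over $m$ converges. In particular, for $\ell=2$, $\gamma=1-\log 2+\sum_{m\ge1}\frac{(-1)^{m-1}e_m}{m+1}\bigl(2^{-m-1}+3^{-m-1}\bigr)$, and for $\ell=3$, $\gamma=1+\frac12+\frac13-2\log2+\sum_{m\ge1}\frac{(-1)^{m-1}e_m}{m+1}\bigl(4^{-m-1}+5^{-m-1}+6^{-m-1}+7^{-m-1}\bigr)$.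
   Context: The sequence $(e_m)_{m\geq0}$ of rational numbers is defined by $e_0=0$ and, for $m\geq1$, $$e_m=\frac{2^{m+1}+\sum_{j=1}^{m}\binom{m+1}{j}e_{m-j}}{2^{m+1}-2}.$$ (So $e_1=2$, etc.) $\gamma=0.5772\ldots$ denotes Euler's constant. *)

(* Defs.v *)
From mathcomp Require Import all_boot all_order all_algebra.
From mathcomp Require Import all_classical all_reals all_analysis.
Set Implicit Arguments. Unset Strict Implicit. Unset Printing Implicit Defensive.
Import Order.TTheory GRing.Theory Num.Theory.
Import numFieldNormedType.Exports.
Local Open Scope ring_scope.

(* e_list m = [:: e_0; e_1; ...; e_m]  (course-of-values recursion) *)
Fixpoint e_list (m : nat) : seq rat :=
  match m with
  | 0%N => [:: 0]
  | m'.+1 =>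
      let prev := e_list m' in
      let k := m'.+1 in
      rcons prev
        ((2 ^+ k.+1 + \sum_(1 <= j < k.+1) ('C(k.+1, j))%:R * nth 0 prev (k - j)%N)
         / (2 ^+ k.+1 - 2))
  end.

Definition e_seq (m : nat) : rat := nth 0 (e_list m) m.

Definition euler_gamma (R : realType) : R :=
  limn (fun n : nat => \sum_(1 <= k < n.+2) (k%:R)^-1 - ln (n.+1)%:R).

(* Main.v *)
Require Import Defs.
From mathcomp Require Import all_boot all_order all_algebra.
From mathcomp Require Import all_classical all_reals all_analysis.
From mathcomp Require Import ring lra zify.
Import Order.TTheory GRing.Theory Num.Theory.
Import numFieldNormedType.Exports.
Local Open Scope ring_scope.

(* Put [v = 1/n] and [G(v) = sum_m (-1)^(m-1) e_m v^(m+1) / (m+1)].  The recurrence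
   of [e_m] says exactly that
     [G(1/n) = 1/n - ln(1 + 1/n) + G(1/(2n)) + G(1/(2n+1))].
   Summing over a dyadic block [2^k <= n < 2^(k+1)], the last two terms give the
   sum over the next block and the logarithms telescope to [ln 2], so
     [sum_block_k G + H_(2^k - 1) - k ln 2]
   does not depend on [k].  As [0 <= e_m <= m + 1], the block sums tend to [0], and
   the constant is Euler's. *)

(** * The sequence [e_seq]: recurrence and bounds *)

Lemma size_e_list m : size (e_list m) = m.+1.
Proof. by elim: m => //= m IH; rewrite size_rcons IH. Qed.

Lemma nth_e_list m i : (i <= m)%N -> nth 0 (e_list m) i = e_seq i.
Proof.
elim: m => [|m IH] im; first by case: i im.
have [->//|nim] := eqVneq i m.+1.
have im' : (i <= m)%N by lia.
by rewrite /= nth_rcons size_e_list ltnS im' IH.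
Qed.

Lemma e_seq0 : e_seq 0 = 0. Proof. by []. Qed.

Lemma exp2_gt2 (F : realFieldType) k : 2 < 2 ^+ k.+2 :> F.
Proof.
have h : 1 < 2 ^+ k.+1 :> F by rewrite exprn_egt1 // ltr1n.
by rewrite exprS ltr_pMr.
Qed.

Lemma e_seqS k : e_seq k.+1 =
  (2 ^+ k.+2 + \sum_(m < k.+1) 'C(k.+2, m.+1)%:R * e_seq m) / (2 ^+ k.+2 - 2).
Proof.
rewrite {1}/e_seq [LHS]/= nth_rcons size_e_list ltnn eqxx.
congr ((_ + _) / _); rewrite big_add1 /= big_nat_rev big_mkord /=.
apply: eq_bigr => i _; have im := ltn_ord i.
have -> : (k.+1 - (0 + k.+1 - i.+1).+1)%N = i by lia.
rewrite nth_e_list -1?ltnS //; congr (_ %:R * _).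
by rewrite -bin_sub; [congr 'C(_, _); lia|lia].
Qed.

(** The [- 2] of the denominator is split into two copies of [e_seq k.+1]: the separate term and the
    summand [m = k.+1]. The left side and the last two terms on the right become, after
    normalisation, the coefficients of G(v), G(v/2) and G(v/(2+v)). *)
Lemma e_seq_rec k : 2 ^+ k.+2 * e_seq k.+1 =
  2 ^+ k.+2 + e_seq k.+1 + \sum_(m < k.+2) 'C(k.+2, m.+1)%:R * e_seq m.
Proof.
rewrite big_ord_recr /= binn mul1r.
have h : 2 ^+ k.+2 - 2 != 0 :> rat by rewrite subr_eq0 gt_eqF // exp2_gt2.
have: (2 ^+ k.+2 - 2) * e_seq k.+1 =
  2 ^+ k.+2 + \sum_(m < k.+1) 'C(k.+2, m.+1)%:R * e_seq m.
  by rewrite e_seqS; field.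
by move: (\sum_(_ < _) _) (e_seq _) (2 ^+ _) => s e x; lra.
Qed.

Lemma sum_bin n : (\sum_(i < n.+1) 'C(n, i) = 2 ^ n)%N.
Proof.
by rewrite (expnDn 1 1); apply: eq_bigr => i _; rewrite !exp1n !muln1.
Qed.

(** By absorption each summand is [k.+2] times ['C(k.+1, m)], and only [m = k.+1] is missing from
    the full binomial row. This evaluates the recurrence on the inductive bound in
    [e_seq_bounds]. *)
Lemma sum_bin_mul k : (\sum_(m < k.+1) 'C(k.+2, m.+1) * m.+1 = k.+2 * (2 ^ k.+1 - 1))%N.
Proof.
under eq_bigr do rewrite mulnC -mul_bin_diag.
rewrite -big_distrr /=; congr muln.
by rewrite -sum_bin [in RHS]big_ord_recr /= binn addnK.
Qed.

Lemma e_seq_bounds m : 0 <= e_seq m <= m.+1%:R.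
Proof.
elim/ltn_ind: m => -[|k] IH; first by rewrite e_seq0 lexx ler0n.
have h : 2 < 2 ^+ k.+2 :> rat by exact: exp2_gt2.
rewrite e_seqS; set s := \sum_(_ < _) _.
have s0 : 0 <= s.
  apply: sumr_ge0 => i _; rewrite mulr_ge0 // ?ler0n //.
  by case/andP: (IH i (ltn_ord i)).
have sle : s <= k.+2%:R * (2 ^+ k.+1 - 1).
  have -> : k.+2%:R * (2 ^+ k.+1 - 1) = (k.+2 * (2 ^ k.+1 - 1))%:R :> rat.
    by rewrite natrM natrB ?expn_gt0 // natrX.
  rewrite -sum_bin_mul natr_sum; apply: ler_sum => i _.
  rewrite natrM ler_wpM2l ?ler0n //.
  by case/andP: (IH i (ltn_ord i)).
apply/andP; split; first by rewrite divr_ge0 //; lra.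
rewrite ler_pdivrMr; last lra.
(* For [k = 0] the bound [sle] is too weak, but there [s] is a multiple of [e_seq 0 = 0]. For k >= 1
   the inequality 2^(k+2) <= (k+2)(2^(k+1) - 1) holds and suffices. *)
case: k => [|k] in IH h s s0 sle *.
  by rewrite /s big_ord_recr big_ord0 /= e_seq0; lra.
have k2 : 3 <= k.+3%:R :> rat by rewrite ler_nat.
move: sle; rewrite !(exprS 2 k.+2).
set x := 2 ^+ k.+2; set y := k.+3%:R in k2 *.
have x4 : 4 <= x.
  have z1 : 1 <= 2 ^+ k :> rat by rewrite exprn_ege1 // ler1n.
  by rewrite /x !exprS; move: (2 ^+ k) z1 => z z1; lra.
by nra.
Qed.

(** * Truncated negative binomial series *)

Lemma bin_gen_step (F : comNzRingType) (y : F) m n :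
  (1 - y) * \sum_(M < n.+1) 'C(M, m.+1)%:R * y ^+ M.+1 =
  y * (\sum_(M < n) 'C(M, m)%:R * y ^+ M.+1) - 'C(n, m.+1)%:R * y ^+ n.+2.
Proof.
(* Pascal's rule: multiplication by [1 - y] lowers column [m.+1] to column [m], up to a boundary
   term due to the truncation. *)
elim: n => [|n IH]; first by rewrite big_ord_recr !big_ord0 /= bin0n /=; ring.
rewrite big_ord_recr /= mulrDr IH [in RHS]big_ord_recr /= binS natrD.
by rewrite !(exprS y n.+2) !(exprS y n.+1); ring.
Qed.

(* Multiplying the remainder by [1 + u] lowers [m] and [N] simultaneously. *)
Lemma negbin_remainder (F : realFieldType) (u : F) m N : 0 <= u -> (m <= N)%N ->
  `|(- (u / (1 + u))) ^+ m.+1 - \sum_(M < N.+1) 'C(M, m)%:R * (- u) ^+ M.+1|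
    <= 'C(N.+1, m)%:R * u ^+ N.+2.
Proof.
move=> u0; have u1 : 0 < 1 + u by lra.
have u1N : 1 + u != 0 by rewrite gt_eqF.
have shrink (d b : F) : `|(1 + u) * d| <= b -> `|d| <= b.
  apply: le_trans; rewrite normrM (gtr0_norm u1) ler_peMl //; lra.
have nX k : `|(- u) ^+ k| = u ^+ k by rewrite normrX normrN ger0_norm.
elim: m N => [|m IH] [|N] // mN; apply: shrink.
- rewrite big_ord_recr big_ord0 /= bin0 expr1 !mul1r.
  have -> : (1 + u) * (- (u / (1 + u)) - (0 + (- u) ^+ 1)) = (- u) ^+ 2 by field.
  by rewrite nX.
- under eq_bigr do rewrite bin0 mul1r exprS.
  rewrite -mulr_sumr bin0 mul1r.
  have := subrX1 (- u) N.+2; move: (\sum_(_ < _) _) => s.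
  rewrite -nX (exprS (- u) N.+2); move: ((- u) ^+ N.+2) => p h.
  suff -> : (1 + u) * ((- (u / (1 + u))) ^+ 1 - - u * s) = - u * p by [].
  have -> : p = 1 + (- u - 1) * s by rewrite -h; ring.
  by rewrite expr1; field.
have := bin_gen_step _ (- u) m N.+1; rewrite opprK => bE.
have h := IH N mN.
rewrite mulrBr bE exprS.
set z := - (u / (1 + u)); set S := \sum_(_ < _) _ in h *.
have -> : (1 + u) * (z * z ^+ m.+1) = - u * z ^+ m.+1.
  by rewrite mulrA; congr (_ * _); rewrite /z; field.
(* Two errors remain: the boundary term, with ['C(N.+1, m.+1)], and [u] times the inductive error,
   with ['C(N.+1, m)]. Pascal's rule adds them to the claimed bound. *)
rewrite opprB addrCA -mulrBr; apply: le_trans (ler_normD _ _) _.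
rewrite [`|_ * (- u) ^+ _|]normrM nX.
rewrite [`|- u * _|]normrM normrN (ger0_norm u0) normr_nat.
rewrite [in leRHS]binS natrD mulrDl lerD2l (exprS u N.+2) mulrCA.
by rewrite ler_wpM2l.
Qed.

(** * Partial sums and the functional equation up to truncation *)

Section Series.
Variable R : realType.
Implicit Types u v : R.

Definition e_coef (m : nat) : R := ratr (e_seq m) / m.+1%:R.

Lemma e_coef0 : e_coef 0 = 0. Proof. by rewrite /e_coef e_seq0 rmorph0 mul0r. Qed.

Lemma e_coef_bounds m : 0 <= e_coef m <= 1.
Proof.
have /andP[e0 e1] := e_seq_bounds m.
rewrite /e_coef divr_ge0 ?ler0n ?ler0q //= ler_pdivrMr ?ltr0n // mul1r.
by rewrite -ratr_nat ler_rat.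
Qed.

(** Division of [e_seq_rec] by [k.+2] turns ['C(k.+2, m.+1)] into ['C(k.+1, m)], the coefficient of
    (-u)^(k+2) in the expansion of (-u/(1+u))^(m+1). *)
Lemma e_coef_rec k : 2 ^+ k.+2 * e_coef k.+1 =
  2 ^+ k.+2 / k.+2%:R + e_coef k.+1 + \sum_(m < k.+2) 'C(k.+1, m)%:R * e_coef m.
Proof.
have n0 i : i.+1%:R != 0 :> R by rewrite pnatr_eq0.
have fE : ratr (e_seq k.+1) = e_coef k.+1 * k.+2%:R by rewrite divfK.
have sE : ratr (\sum_(m < k.+2) 'C(k.+2, m.+1)%:R * e_seq m) =
    (\sum_(m < k.+2) 'C(k.+1, m)%:R * e_coef m) * k.+2%:R.
  rewrite rmorph_sum mulr_suml; apply: eq_bigr => i _ /=.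
  rewrite rmorphM /= ratr_nat -[ratr (e_seq i)](divfK (n0 i)) -/(e_coef i).
  have /(congr1 (fun n => n%:R : R)) := mul_bin_diag k.+2 i; rewrite !natrM /= => h.
  by rewrite mulrA mulrAC [_ * i.+1%:R]mulrC -h; ring.
have /(congr1 (@ratr R)) := e_seq_rec k.
rewrite rmorphM !rmorphD /= rmorphXn /= ratr_nat fE sE.
move: (2 ^+ k.+2) (e_coef k.+1) (\sum_(_ < _) _) => x f s h.
by apply: (mulIf (n0 k.+1)); rewrite !mulrDl divfK // -mulrA.
Qed.

(** Partial sum of G(u): the sign (-1)^(m-1) equals (-1)^(m+1) and is absorbed into the power of
    [- u]. *)
Definition e_psum (N : nat) (u : R) : R := \sum_(m < N.+1) e_coef m * (- u) ^+ m.+1.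

(** Taylor polynomial of -ln(1 + v), hence the plus sign in front of it below. *)
Definition ln_psum (N : nat) (v : R) : R := \sum_(m < N) (- v) ^+ m.+1 / m.+1%:R.

(** An exact polynomial identity, obtained by comparing coefficients of powers of -(v/2). With u =
    v/2 one has v/(2+v) = u/(1+u), so the double sum is a truncated expansion of G(v/(2+v)). *)
Lemma e_psum_double N v : e_psum N v =
  v + ln_psum N.+1 v + e_psum N (v / 2) +
  \sum_(m < N.+1) e_coef m * \sum_(M < N.+1) 'C(M, m)%:R * (- (v / 2)) ^+ M.+1.
Proof.
have -> : \sum_(m < N.+1) e_coef m * \sum_(M < N.+1) 'C(M, m)%:R * (- (v / 2)) ^+ M.+1
  = \sum_(M < N.+1) (- (v / 2)) ^+ M.+1 * \sum_(m < M.+1) 'C(M, m)%:R * e_coef m.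
  under eq_bigr do rewrite mulr_sumr.
  rewrite exchange_big; apply: eq_bigr => M _ /=.
  rewrite mulr_sumr -(big_mkord xpredT
    (fun i => (- (v / 2)) ^+ M.+1 * ('C(M, i)%:R * e_coef i))).
  rewrite -(big_mkord xpredT (fun i => e_coef i * ('C(M, i)%:R * (- (v / 2)) ^+ M.+1))).
  rewrite (big_cat_nat (n := M.+1)) //=.
  rewrite [X in _ + X]big_nat_cond [X in _ + X]big1 ?addr0; last first.
    by move=> i /andP[/andP[Mi _] _]; rewrite bin_small // mul0r mulr0.
  by apply: eq_bigr => i _; ring.
(* In degree one, [v] cancels the first term of [ln_psum] and all else vanishes since
   [e_coef 0 = 0]; the higher degrees are [e_coef_rec]. *)
rewrite /ln_psum /e_psum ![\sum_(_ < N.+1) _]big_ord_recl /=.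
rewrite !big_ord_recl !big_ord0 /= !e_coef0 expr1 divr1.
rewrite -[LHS]add0r.
suff -> : \sum_(i < N) e_coef (lift ord0 i) * (- v) ^+ (lift ord0 i).+1 =
  \sum_(i < N) ((- v) ^+ (lift ord0 i).+1 / (lift ord0 i).+1%:R +
   e_coef (lift ord0 i) * (- (v / 2)) ^+ (lift ord0 i).+1 +
   (- (v / 2)) ^+ (lift ord0 i).+1 *
     \sum_(m < (lift ord0 i).+1) 'C(lift ord0 i, m)%:R * e_coef m).
  by rewrite !big_split /=; ring.
apply: eq_bigr => i _; rewrite lift0.
have := e_coef_rec i; set s := \sum_(_ < _) _ => h.
have vE : - v = 2 * - (v / 2) by field.
rewrite {1 2}vE exprMn; move: h.
have : i.+2%:R != 0 :> R by rewrite pnatr_eq0.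
move: (2 ^+ i.+2) (i.+2%:R : R) (e_coef i.+1) ((- (v / 2)) ^+ i.+2) => x n g w n0 h.
by rewrite mulrA [_ * x]mulrC h; field.
Qed.

(** Since the coefficients lie in [0, 1], the errors of [negbin_remainder] add up to at most 2^(N+1)
    (v/2)^(N+2), which is v^(N+1) v/2. *)
Lemma e_psum_funeq N v : 0 <= v ->
  `|e_psum N v - (v + ln_psum N.+1 v) - e_psum N (v / 2) - e_psum N (v / (2 + v))|
    <= v * v ^+ N.+1.
Proof.
move=> v0; rewrite e_psum_double.
set a := v + _; set b := e_psum _ _; set T := \sum_(_ < _) _.
have -> : a + b + T - a - b = T by ring.
have -> : v / (2 + v) = (v / 2) / (1 + v / 2) by field; lra.
rewrite distrC /e_psum /T -sumrB; apply: le_trans (ler_norm_sum _ _ _) _.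
have u0 : 0 <= v / 2 by lra.
apply: (@le_trans _ _ (\sum_(m < N.+1) 'C(N.+1, m)%:R * (v / 2) ^+ N.+2)).
  apply: ler_sum => m _; rewrite -mulrBr normrM.
  have /andP[f0 f1] := e_coef_bounds m.
  rewrite (ger0_norm f0); have mN : (m <= N)%N by rewrite -ltnS.
  apply: le_trans _ (negbin_remainder _ _ _ _ u0 mN).
  by rewrite ler_piMl.
rewrite -mulr_suml -natr_sum.
apply: (@le_trans _ _ ((2 ^ N.+1)%:R * (v / 2) ^+ N.+2)).
  rewrite ler_wpM2r ?exprn_ge0 // ler_nat -sum_bin [leqRHS]big_ord_recr /=.
  exact: leq_addr.
rewrite natrX (exprS (v / 2)) mulrCA -exprMn [2 * _]mulrC divfK ?pnatr_eq0 //.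
by rewrite ler_wpM2r ?exprn_ge0 //; lra.
Qed.

(** * Taylor remainder of the logarithm *)

Lemma ln_psum_remainder N v : 0 <= v -> `|ln (1 + v) + ln_psum N v| <= v ^+ N.+1.
Proof.
move=> v0.
(* Mean value theorem for [g] on [0, v]: [g] vanishes at 0, and the geometric sum collapses its
   derivative to [dg]. *)
pose g (x : R) : R := ln (1 + x) + ln_psum N x.
pose dg (x : R) : R := (- x) ^+ N / (1 + x).
have gd (x : R) : 0 <= x -> is_derive x 1 g (dg x).
  move=> x0.
  have d1 : is_derive x 1 (fun x => ln (1 + x)) (1 + x)^-1.
    have l1 : 0 < 1 + x by lra.
    have dl := is_derive1_ln l1.
    have da : is_derive x 1 (cst 1 + id : R -> R) 1.
      by apply: is_derive_eq; rewrite add0r.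
    have := is_derive1_comp dl da; rewrite mulr1; exact.
  have d2 : is_derive x 1 (fun x : R => ln_psum N x) (- \sum_(m < N) (- x) ^+ m).
    have -> : (fun x : R => ln_psum N x) =
        \sum_(m < N) (m.+1%:R^-1 *: (- id : R -> R) ^+ m.+1).
      apply/funext => y; rewrite fct_sumE /ln_psum; apply: eq_bigr => i _.
      by rewrite mulrC /GRing.scale /= exprfctE.
    rewrite -sumrN; apply: is_derive_sum => i.
    apply: is_derive_eq.
    by rewrite /= /GRing.scale /= mulrN1 mulrN mulrA mulVf ?mul1r // pnatr_eq0.
  apply: (is_derive_eq (is_deriveD d1 d2)).
  have := subrX1 (- x) N; rewrite /dg; move: (\sum_(_ < _) _) => s h.
  have -> : (- x) ^+ N = 1 + (- x - 1) * s by rewrite -h; ring.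
  by field; lra.
have [c] : exists2 c, c \in `[0, v] & g v - g 0 = dg c * (v - 0).
  apply: MVT_segment => //.
    by move=> x; rewrite in_itv /= => /andP[/ltW x0 _]; exact: gd.
  apply: derivable_within_continuous => x; rewrite in_itv /= => /andP[x0 _].
  by have [] := gd x x0.
rewrite in_itv /= => /andP[c0 cv].
have -> : g 0 = 0.
  rewrite /g addr0 ln1 add0r /ln_psum big1 // => i _.
  by rewrite oppr0 expr0n mul0r.
rewrite !subr0 => gE; rewrite -/(g v) gE normrM (ger0_norm v0) exprSr.
rewrite ler_wpM2r // /dg normrM normrX normrN (ger0_norm c0) normfV ger0_norm; last lra.
rewrite ler_pdivrMr; last lra.
apply: (@le_trans _ _ (v ^+ N)); first by apply: lerXn2r.
by rewrite ler_peMr ?exprn_ge0 //; lra.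
Qed.

(** * Passage to the limit: the function G and its functional equation *)

Local Open Scope classical_set_scope.

Lemma cvg_norm_le (x b : R ^nat) (l : R) :
  (forall n, `|x n - l| <= b n) -> b @ \oo --> 0 -> x @ \oo --> l.
Proof.
move=> xb b0; apply: (@squeeze_cvgr _ _ _ _ (fun n => l - b n) (fun n => l + b n)).
- by apply: nearW => n; rewrite -ler_distl.
- by rewrite -[X in _ --> X]subr0; apply: cvgB => //; exact: cvg_cst.
- by rewrite -[X in _ --> X]addr0; apply: cvgD => //; exact: cvg_cst.
Qed.

Definition e_sum v : R := limn (fun N => e_psum N v).

Lemma e_psum_cvg v : 0 <= v < 1 -> e_psum N v @[N --> \oo] --> e_sum v.
Proof.
move=> /andP[v0 v1].
pose t : R ^nat := fun m => e_coef m * (- v) ^+ m.+1.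
have ct : cvgn (series t).
  apply: normed_cvg; apply: (series_le_cvg (v_ := geometric v v)).
  - by move=> n /=.
  - by move=> n /=; rewrite mulr_ge0 // exprn_ge0.
  - move=> n /=; have /andP[f0 f1] := e_coef_bounds n.
    rewrite normrM normrX normrN (ger0_norm v0) (ger0_norm f0) exprS.
    by rewrite ler_piMl // mulr_ge0 // exprn_ge0.
  - by apply: is_cvg_geometric_series; rewrite ger0_norm.
have -> : (fun N => e_psum N v) = (fun N => series t N.+1).
  by apply/funext => N; rewrite seriesEord.
rewrite /e_sum.
have -> : (fun N => e_psum N v) = (fun N => series t N.+1).
  by apply/funext => N; rewrite seriesEord.
apply/cvg_ex; exists (limn (series t)).
by rewrite (cvg_shiftS (series t)).
Qed.

(** The bound is quadratic because [e_coef 0 = 0], which lets a block of 2^n values near 2^(-n) have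
    a vanishing sum. The factor 2 bounds 1/(1 - v). *)
Lemma e_psum_le N v : 0 <= v <= 2^-1 -> `|e_psum N v| <= 2 * v ^+ 2.
Proof.
move=> /andP[v0 v1]; rewrite /e_psum big_ord_recl e_coef0 mul0r add0r.
apply: le_trans (ler_norm_sum _ _ _) _.
apply: (@le_trans _ _ (\sum_(i < N) v ^+ 2 * v ^+ i)).
  apply: ler_sum => i _; rewrite lift0.
  have /andP[f0 f1] := e_coef_bounds i.+1.
  rewrite normrM normrX normrN (ger0_norm v0) (ger0_norm f0) -exprD add2n.
  by rewrite ler_piMl // exprn_ge0.
rewrite -mulr_sumr mulrC ler_wpM2r ?exprn_ge0 //.
have p0 : 0 <= v ^+ N by exact: exprn_ge0.
have s0 : 0 <= \sum_(i < N) v ^+ i by apply: sumr_ge0 => i _; exact: exprn_ge0.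
by have := subrX1 v N; move: (v ^+ N) p0 (\sum_(_ < _) _) s0 => p p0 s s0; nra.
Qed.

Lemma e_sum_le v : 0 <= v <= 2^-1 -> `|e_sum v| <= 2 * v ^+ 2.
Proof.
move=> hv; have cv : e_psum N v @[N --> \oo] --> e_sum v.
  by apply: e_psum_cvg; case/andP: hv => -> ? /=; lra.
rewrite ler_norml; apply/andP; split.
  rewrite /e_sum; apply: limr_ge; first exact: (cvgP _ cv).
  by apply: nearW => N; have := e_psum_le N v hv; rewrite ler_norml => /andP[].
rewrite /e_sum; apply: limr_le; first exact: (cvgP _ cv).
by apply: nearW => N; have := e_psum_le N v hv; rewrite ler_norml => /andP[].
Qed.

Lemma ln_psum_cvg v : 0 <= v < 1 -> ln_psum N v @[N --> \oo] --> - ln (1 + v).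
Proof.
move=> /andP[v0 v1]; apply: (@cvg_norm_le _ (fun N => v ^+ N.+1)).
  by move=> N; rewrite opprK addrC; exact: ln_psum_remainder.
by rewrite (cvg_shiftS (fun N => v ^+ N)); apply: cvg_expr; rewrite ger0_norm.
Qed.

(** At v = 1/n the two smaller arguments are 1/(2n) and 1/(2n+1). *)
Lemma e_sum_funeq v : 0 <= v <= 2^-1 ->
  e_sum v = v - ln (1 + v) + e_sum (v / 2) + e_sum (v / (2 + v)).
Proof.
move=> /andP[v0 vh].
have v1 : 0 <= v < 1 by apply/andP; split; lra.
have v2 : 0 <= v / 2 < 1 by apply/andP; split; lra.
have v3 : 0 <= v / (2 + v) < 1.
  by rewrite divr_ge0 //=; [rewrite ltr_pdivrMr; lra|lra].
pose D N := e_psum N v - (v + ln_psum N.+1 v) - e_psum N (v / 2)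
   - e_psum N (v / (2 + v)).
have D0 : D N @[N --> \oo] --> 0.
  apply: (@cvg_norm_le _ (fun N => v ^+ N.+1)).
    move=> N; rewrite subr0; apply: le_trans (e_psum_funeq N v v0) _.
    by rewrite ler_piMl ?exprn_ge0 //; lra.
  rewrite (cvg_shiftS (fun N => v ^+ N)); apply: cvg_expr.
  by rewrite ger0_norm //; lra.
have D1 : D N @[N --> \oo] -->
    e_sum v - (v + - ln (1 + v)) - e_sum (v / 2) - e_sum (v / (2 + v)).
  apply: cvgB; last exact: e_psum_cvg.
  apply: cvgB; last exact: e_psum_cvg.
  apply: cvgB; first exact: e_psum_cvg.
  apply: cvgD; first exact: cvg_cst.
  by rewrite (cvg_shiftS (fun N => ln_psum N v)); exact: ln_psum_cvg.
have E : 0 = e_sum v - (v + - ln (1 + v)) - e_sum (v / 2) - e_sum (v / (2 + v)).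
  exact: (cvg_unique _ D0 D1).
move: (e_sum v) (e_sum (v / 2)) (e_sum (v / (2 + v))) (ln (1 + v)) E.
by move=> x y z w; lra.
Qed.

(** * Harmonic numbers and Euler's constant *)

Definition harm (n : nat) : R := \sum_(1 <= k < n) k%:R^-1.

(** As [harm n] is H_(n-1), this is H_(n+1) - ln(n+1), the sequence under the limit in
    [euler_gamma]. *)
Definition gammaseq (n : nat) : R := harm n.+2 - ln n.+1%:R.

Lemma sum_ln_ratio a b : (0 < a <= b)%N ->
  \sum_(a <= i < b) ln (1 + i%:R^-1) = ln b%:R - ln a%:R :> R.
Proof.
move=> /andP[a0 ab]; rewrite -(@telescope_sumr _ a b (fun k => ln k%:R : R)) //.
rewrite big_nat_cond [RHS]big_nat_cond.
apply: eq_bigr => i /andP[/andP[ai _] _].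
have i0 : 0 < i%:R :> R by rewrite ltr0n; lia.
rewrite -ln_div ?posrE ?ltr0n //; last by lia.
by congr ln; rewrite -natr1; field; rewrite gt_eqF.
Qed.

(** It decreases because ln(1 - x) <= -x at x = 1/(n+2), and it is nonnegative because summing ln(1
    + 1/k) <= 1/k gives ln(n+2) <= H_(n+1). *)
Lemma gammaseq_is_cvg : cvgn gammaseq.
Proof.
apply: nonincreasing_is_cvgn.
  apply/nonincreasing_seqP => n; rewrite /gammaseq /harm [in leLHS]big_nat_recr //=.
  have n0 : 0 < n.+2%:R :> R by rewrite ltr0n.
  have n1 : 0 < n.+1%:R :> R by rewrite ltr0n.
  have h : -1 < - n.+2%:R^-1 :> R.
    by rewrite ltrN2 invf_lt1 // ltr1n.
  have := le_ln1Dx h.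
  have -> : 1 - n.+2%:R^-1 = n.+1%:R / n.+2%:R :> R.
    rewrite -(natr1 n.+1); move: (n.+1%:R : R) n1 => x x0; field.
    by rewrite gt_eqF //; lra.
  rewrite ln_div ?posrE //.
  move: (\sum_(_ <= _ < _) _) (ln n.+1%:R) (ln n.+2%:R) n.+2%:R^-1.
  by move=> s x y z; lra.
exists 0 => _ [n _ <-]; rewrite /gammaseq /harm.
have h : ln n.+2%:R <= \sum_(1 <= k < n.+2) k%:R^-1 :> R.
  have := @sum_ln_ratio 1 n.+2 isT; rewrite ln1 subr0 => <-.
  apply: ler_sum => i _; apply: le_ln1Dx.
  by apply: (@lt_le_trans _ _ 0); rewrite ?invr_ge0 ?ler0n //; lra.
have : ln n.+1%:R <= ln n.+2%:R :> R by rewrite ler_ln ?posrE ?ltr0n // ler_nat.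
lra.
Qed.

(** * Dyadic blocks and their invariant *)

Lemma big_nat_double a b (h : nat -> R) :
  \sum_(a.*2 <= i < b.*2) h i = \sum_(a <= i < b) (h i.*2 + h i.*2.+1).
Proof.
have [ab|ba] := leqP a b; last by rewrite !big_geq //; lia.
elim: b ab => [|b IH] ab; first by rewrite !big_geq //; lia.
have [->|nab] := eqVneq a b.+1; first by rewrite !big_geq.
rewrite doubleS big_nat_recr /=; last lia.
rewrite big_nat_recr /=; last lia.
rewrite [in RHS]big_nat_recr /=; last lia.
by rewrite IH ?addrA //; lia.
Qed.

Definition e_block (n : nat) : R := \sum_((2 ^ n)%N <= i < (2 ^ n.+1)%N) e_sum i%:R^-1.

Lemma e_block_rec n : (0 < n)%N ->
  e_block n + harm (2 ^ n) - n%:R * ln 2 =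
  e_block n.+1 + harm (2 ^ n.+1) - n.+1%:R * ln 2.
Proof.
move=> n0; have p0 : (0 < 2 ^ n)%N by rewrite expn_gt0.
have p1 : (2 ^ n <= 2 ^ n.+1)%N by rewrite expnS; lia.
have -> : e_block n.+1 = \sum_((2 ^ n)%N <= i < (2 ^ n.+1)%N)
    (e_sum i.*2%:R^-1 + e_sum i.*2.+1%:R^-1).
  by rewrite -(@big_nat_double _ _ (fun i => e_sum i%:R^-1)) -!mul2n -!expnS.
have -> : e_block n = \sum_((2 ^ n)%N <= i < (2 ^ n.+1)%N)
    (i%:R^-1 - ln (1 + i%:R^-1) + (e_sum i.*2%:R^-1 + e_sum i.*2.+1%:R^-1)).
  rewrite /e_block big_nat_cond [RHS]big_nat_cond.
  apply: eq_bigr => i /andP[/andP[ni _] _].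
  (* Here [0 < n] enters: [e_sum_funeq] requires 1/i <= 1/2. *)
  have i2 : 2 <= i%:R :> R.
    by rewrite ler_nat (leq_trans _ ni) // -{1}(expn1 2) leq_exp2l.
  have i0 : i%:R != 0 :> R by rewrite gt_eqF //; lra.
  rewrite e_sum_funeq; last first.
    by rewrite invr_ge0 ler0n /= lef_pV2 ?posrE; lra.
  rewrite -addrA; congr (_ + (e_sum _ + e_sum _)).
    by rewrite -muln2 natrM invfM.
  rewrite -(natr1 i.*2) -mul2n natrM.
  move: (i%:R : R) i2 i0 => x x2 x0; field.
  by rewrite x0 andbT gt_eqF //; lra.
rewrite big_split sumrB sum_ln_ratio ?p0 //=.
have -> : harm (2 ^ n.+1) = harm (2 ^ n) + \sum_((2 ^ n)%N <= i < (2 ^ n.+1)%N) i%:R^-1.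
  by rewrite /harm -big_cat_nat.
rewrite !natrX !lnXn // mulrS -(natr1 n) -[ln 2 *+ n]mulr_natl.
move: (\sum_(_ <= _ < _) _) (\sum_(_ <= _ < _) _) => s t.
by ring.
Qed.

Lemma e_block_cvg0 : e_block n @[n --> \oo] --> 0.
Proof.
rewrite -(cvg_shiftS e_block).
apply: (@cvg_norm_le _ (geometric 1 2^-1)).
  move=> n; rewrite subr0 /e_block; apply: le_trans (ler_norm_sum _ _ _) _.
  have q0 : 0 < (2 ^ n.+1)%:R :> R by rewrite ltr0n expn_gt0.
  (* There are 2^(n+1) terms, each at most 2/4^(n+1), so the block is at most 2^(-n). *)
  apply: (@le_trans _ _ (\sum_((2 ^ n.+1)%N <= i < (2 ^ n.+2)%N)
      2 * ((2 ^ n.+1)%:R^-1) ^+ 2)).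
    rewrite big_nat_cond [leRHS]big_nat_cond.
    apply: ler_sum => i /andP[/andP[ni _] _].
    have qi : (2 ^ n.+1)%:R <= i%:R :> R by rewrite ler_nat.
    have i2 : 2 <= i%:R :> R.
      by rewrite ler_nat (leq_trans _ ni) // -{1}(expn1 2) leq_exp2l.
    apply: le_trans (e_sum_le _ _) _.
      by rewrite invr_ge0 ler0n /= lef_pV2 ?posrE; lra.
    rewrite ler_wpM2l // lerXn2r ?nnegrE ?invr_ge0 ?ler0n //.
    by rewrite lef_pV2 ?posrE //; lra.
  rewrite sumr_const_nat -[leLHS]mulr_natr /= [leRHS]mul1r [2^-1 ^+ n]exprVn -[2 ^+ n]natrX.
  have -> : (2 ^ n.+2 - 2 ^ n.+1 = 2 ^ n.+1)%N by rewrite [(2 ^ n.+2)%N]expnS; lia.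
  move: q0; rewrite (expnS 2 n) natrM; move: ((2 ^ n)%:R : R) => q q0.
  have qn : q != 0 by rewrite gt_eqF //; lra.
  suff -> : 2 * (2 * q)^-1 ^+ 2 * (2 * q) = q^-1 by [].
  by field.
by apply: cvg_geometric; rewrite ger0_norm; lra.
Qed.

Lemma e_block_eq_gamma n : (0 < n)%N ->
  e_block n + harm (2 ^ n) - n%:R * ln 2 = euler_gamma R.
Proof.
move=> n0.
pose B k : R := e_block k + harm (2 ^ k) - k%:R * ln 2.
have Bconst k : B k.+1 = B n.
  have B1 j : B j.+1 = B 1%N by elim: j => // j <-; exact/esym/e_block_rec.
  by rewrite B1 -(B1 n.-1) prednK.
have p0 k : (0 < 2 ^ k)%N by rewrite expn_gt0.
(* [harm (2 ^ k)] stops at 1/(2^k - 1) whereas [gammaseq (2 ^ k).-1] includes 1/2^k, whence the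
   correction 2^(-k). *)
have BE k : B k = e_block k - 2^-1 ^+ k + gammaseq (2 ^ k).-1.
  rewrite /B /gammaseq prednK // natrX lnXn // -mulr_natl.
  rewrite /harm big_nat_recr //= exprVn natrX.
  by move: (e_block k) (\sum_(_ <= _ < _) _) => a s; ring.
have sub : (2 ^ k).-1 @[k --> \oo] --> \oo.
  apply/cvgnyPge => A; near=> k.
  rewrite -ltnS prednK //; apply: leq_ltn_trans (ltn_expl k _) => //.
  by near: k; exact: nbhs_infty_ge.
have Bg : B k @[k --> \oo] --> euler_gamma R.
  rewrite (_ : B = fun k => e_block k - 2^-1 ^+ k + gammaseq (2 ^ k).-1);
    last exact/funext.
  rewrite -[euler_gamma R]add0r -[X in X + _](subr0 0).
  apply: cvgD; first apply: cvgB.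
  - exact: e_block_cvg0.
  - by apply: cvg_expr; rewrite ger0_norm; lra.
  - exact: (cvg_comp _ _ sub gammaseq_is_cvg).
have Bc : B k @[k --> \oo] --> B n.
  rewrite -(cvg_shiftS B) (_ : [sequence B k.+1]_k = fun=> B n).
    exact: cvg_cst.
  exact/funext.
exact: (cvg_unique _ Bc Bg).
Unshelve. all: by end_near.
Qed.

End Series.

(* Summand indexed by m >= 1; the series term at index k is the m = k+1 term. *)
Theorem theorem1 (R : realType) (l : nat) (hl : (2 <= l)%N) :
  let a : R ^nat := fun k : nat =>
    let m := k.+1 in
    (-1) ^+ (m.-1) * ratr (e_seq m) / (m.+1)%:R *
    \sum_((2 ^ l.-1)%N <= n < (2 ^ l)%N) ((n%:R) ^+ m.+1)^-1 in
  cvgn (series a) /\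
  euler_gamma R =
    \sum_(1 <= n < (2 ^ l.-1)%N) (n%:R)^-1 - (l.-1)%:R * ln 2 + limn (series a).
Proof.
case: l hl => [//|n]; rewrite ltnS => n0 a /=.
(* No index shift occurs: [e_psum] has [N.+1] terms, but the one at [m = 0] vanishes, leaving m = 1,
   ..., N. *)
have aE N : series a N = \sum_((2 ^ n)%N <= i < (2 ^ n.+1)%N) e_psum R N i%:R^-1.
  rewrite seriesEord /= /e_psum.
  under [RHS]eq_bigr do rewrite big_ord_recl e_coef0 mul0r add0r.
  rewrite exchange_big; apply: eq_bigr => k _.
  rewrite lift0 /a /= mulr_sumr; apply: eq_bigr => i _.
  rewrite /e_coef -[- i%:R^-1]mulN1r exprMn exprVn !exprS.
  by ring.
have ca : (series a @ \oo --> e_block R n)%classic.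
  rewrite (_ : series a = fun N => \sum_((2 ^ n)%N <= i < (2 ^ n.+1)%N)
    e_psum R N i%:R^-1); last exact/funext.
  under eq_fun do rewrite big_nat_cond.
  rewrite /e_block big_nat_cond; apply: cvg_big.
    exact: add_continuous.
  move=> i /andP[/andP[ni _] _]; apply: e_psum_cvg.
  have i2 : 2 <= i%:R :> R.
    by rewrite ler_nat (leq_trans _ ni) // -{1}(expn1 2) leq_exp2l.
  by rewrite invr_ge0 ler0n /= invf_lt1; lra.
split; first exact: (cvgP _ ca).
rewrite (cvg_lim _ ca) // -(e_block_eq_gamma R n n0) /harm.
by move: (e_block R n) (\sum_(_ <= _ < _) _) => x y; ring.
Qed.
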